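(* Let $\mathcal{P}(\mathbb{N})$ be the set of probability distributions on $\mathbb{N}=\{0,1,2,\ldots\}$, and let $D_s$ and $W_p$ be the Fourier-based (Toscani) and Wasserstein distances on $\mathcal{P}(\mathbb{N})$ defined in the context. (i) For all $f,g\in\mathcal{P}(\mathbb{N})$, $$D_1(f,g)\leq W_1(f,g).$$ (ii) For all $f,g\in\mathcal{P}(\mathbb{N})$ with the same mean value, i.e. $\sum_{n\geq 0} n f_n=\sum_{n\geq 0} n g_n$, $$D_2(f,g)\leq \frac12\,W_2^2(f,g)+\left(\min\left\{\sum_{n\geq 0} n^2 f_n,\ \sum_{n\geq 0} n^2 g_n\right\}\right)^{\frac12} W_2(f,g).$$ (iii) There is a function $(N,\alpha,m)\mapsto C(N,\alpha,m)\in(0,\infty)$, defined for integers $N\geq 1$ and real numbers $\alpha>0$, $m\geq 0$, such that the following holds. Let $N\geq 1$ be an integer, let $\alpha>0$, and let $f,g\in\mathcal{P}(\mathbb{N})$ have the same mean value and satisfy $\mathrm{supp}(f)\cup\mathrm{supp}(g)\subset\{0,1,\ldots,N\}$ and $$m_{2+\alpha}:=\max\left\{\sum_{n\geq 0} n^{2+\alpha} f_n,\ \sum_{n\geq 0} n^{2+\alpha} g_n\right\}<\infty.$$ Then $$W_2^2(f,g)\leq C(N,\alpha,m_{2+\alpha})\,\left[D_2(f,g)\right]^{\alpha/(1+\alpha)}.$$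
   Context: $\mathcal{P}(\mathbb{N})$ denotes the set of sequences $f=(f_0,f_1,\ldots)$ with $f_n\geq 0$ and $\sum_{n\geq 0} f_n=1$; $\mathrm{supp}(f)=\{n: f_n>0\}$. The probability generating function of $f\in\mathcal{P}(\mathbb{N})$ is $\hat f(z)=\sum_{n\geq 0} z^n f_n$ for $z\in[0,1]$. For $s\geq 1$, the Fourier-based (Toscani) distance of order $s$ between $f,g\in\mathcal{P}(\mathbb{N})$ is $$D_s(f,g)=\sup_{z\in(0,1)}\frac{|\hat f(z)-\hat g(z)|}{|1-z|^s}.$$ For $p\geq 1$, the Wasserstein distance of order $p$ between $f,g\in\mathcal{P}(\mathbb{N})$ is $$W_p(f,g)=\left(\inf_{\pi}\sum_{i\geq 0}\sum_{j\geq 0}\pi_{i,j}\,|i-j|^p\right)^{1/p},$$ where the infimum is over all arrays $\pi=(\pi_{i,j})_{i,j\geq 0}$ with $\pi_{i,j}\geq 0$, $\sum_{j\geq 0}\pi_{i,j}=f_i$ for all $i$, and $\sum_{i\geq 0}\pi_{i,j}=g_j$ for all $j$. All these quantities, and the moments, take values in $[0,\infty]$, with the convention $0\cdot\infty=0$. $W_2^2(f,g)$ means $(W_2(f,g))^2$. *)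

(* Defs.v *)
From HB Require Import structures.
From mathcomp Require Import all_boot all_order all_algebra.
From mathcomp Require Import all_classical all_reals all_analysis.
Set Implicit Arguments.
Unset Strict Implicit.
Unset Printing Implicit Defensive.
Import Order.TTheory GRing.Theory Num.Theory.
Import numFieldNormedType.Exports.
Local Open Scope classical_set_scope.
Local Open Scope ring_scope.

Definition distrN (R : realType) : set (nat -> R) :=
  [set f | (forall n, 0 <= f n) /\ (\sum_(0 <= n <oo) (f n)%:E = 1)%E].

Definition supp (R : realType) (f : nat -> R) : set nat := [set n | 0 < f n].

(* The exponent is real; for r != 0 the term n = 0 vanishes since 0 `^ r = 0. *)
Definition moment (R : realType) (r : R) (f : nat -> R) : \bar R :=
  (\sum_(0 <= n <oo) (n%:R `^ r * f n)%:E)%E.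

(* Real-valued limit: it exists for 0 <= z <= 1 when f is in [distrN], and pgf is
   only evaluated there. *)
Definition pgf (R : realType) (f : nat -> R) (z : R) : R :=
  limn (series (fun n => z ^+ n * f n)).

Definition toscani (R : realType) (s : R) (f g : nat -> R) : \bar R :=
  ereal_sup [set (`|pgf f z - pgf g z| / `|1 - z| `^ s)%:E
            | z in [set z : R | 0 < z < 1]].

Definition couplings (R : realType) (f g : nat -> R)
    : set (nat -> nat -> R) :=
  [set pi | [/\ forall i j, 0 <= pi i j,
    forall i, (\sum_(0 <= j <oo) (pi i j)%:E = (f i)%:E)%E &
    forall j, (\sum_(0 <= i <oo) (pi i j)%:E = (g j)%:E)%E]].

(* The infimum may be +oo, in which case so is its p^-1-th power. *)
Definition wasserstein (R : realType) (p : R) (f g : nat -> R) : \bar R :=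
  ((ereal_inf
     [set \sum_(0 <= i <oo) \sum_(0 <= j <oo)
            (pi i j * `|i%:R - j%:R| `^ p)%:E
     | pi in couplings f g]) `^ p^-1)%E.

(* Main.v *)
(** Both upper bounds come from comparing h(i) with h(j) and summing against an
    arbitrary coupling.  For D_1 one takes h(n) = z^n, which is (1-z)-Lipschitz.
    For D_2 equality of the means allows the linear correction
    h(n) = z^n + (1-z) n, whose increments (1-z)(1-z^n) lie in [0, (1-z)^2 n];
    hence |h(i) - h(j)| <= (1-z)^2 (|i-j|^2 / 2 + i |i-j|), and the last product
    is split by AM-GM with a weight optimised at the end, in place of
    Cauchy-Schwarz.

    For (iii), keeping the common mass in place bounds W_2^2 by N^2 times the
    total variation, which is at most 1; and the coefficients of the polynomial
    pgf f - pgf g of degree N are linear functions of its values at N + 1 points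
    of (0, 1), hence bounded by a constant times D_2.  So W_2^2 is at most
    N^2 min(1, K_N D_2), which is at most N^2 (1 + K_N) D_2^theta for every
    theta in (0, 1]. *)

Require Import Defs.
From HB Require Import structures.
From mathcomp Require Import all_boot all_order all_algebra.
From mathcomp Require Import all_classical all_reals all_analysis.
From mathcomp Require Import ring lra.
Set Implicit Arguments.
Unset Strict Implicit.
Import Order.TTheory GRing.Theory Num.Theory.
Import numFieldNormedType.Exports.
Local Open Scope classical_set_scope.
Local Open Scope ring_scope.

(** * Expectations, transport costs and their symmetries *)

Definition expect (R : realType) (f u : nat -> R) : \bar R :=
  (\sum_(0 <= n <oo) (u n * f n)%:E)%E.

Definition transport_cost (R : realType) (p : R) (pi : nat -> nat -> R) :
    \bar R :=
  (\sum_(0 <= i <oo) \sum_(0 <= j <oo) (pi i j * `|i%:R - j%:R| `^ p)%:E)%E.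

Lemma couplings_sym (R : realType) (f g : nat -> R) (pi : nat -> nat -> R) :
  couplings f g pi -> couplings g f (fun i j => pi j i).
Proof. by case=> pi0 fE gE; split. Qed.

Lemma transport_cost_sym (R : realType) (p : R) (pi : nat -> nat -> R) :
  (forall i j, 0 <= pi i j) ->
  transport_cost p (fun i j => pi j i) = transport_cost p pi.
Proof.
move=> pi0; rewrite /transport_cost nneseries_interchange; last first.
  by move=> i j; rewrite lee_fin mulr_ge0 ?powR_ge0.
by apply: eq_eseriesr => j _; apply: eq_eseriesr => i _; rewrite distrC.
Qed.

Lemma transport_cost_ge0 (R : realType) (p : R) (pi : nat -> nat -> R) :
  (forall i j, 0 <= pi i j) -> (0 <= transport_cost p pi)%E.
Proof.
move=> pi0; apply: nneseries_ge0 => i _ _; apply: nneseries_ge0 => j _ _.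
by rewrite lee_fin mulr_ge0 ?powR_ge0.
Qed.

(** The p-th power of the Wasserstein distance. All estimates are made at this level, and the root
    is taken only at the end. *)
Definition inf_cost (R : realType) (p : R) (f g : nat -> R) : \bar R :=
  ereal_inf (transport_cost p @` couplings f g).

Lemma wassersteinE (R : realType) (p : R) (f g : nat -> R) :
  wasserstein p f g =
  (inf_cost p f g `^ p^-1)%E.
Proof. by []. Qed.

Lemma inf_cost_ge0 (R : realType) (p : R) (f g : nat -> R) :
  (0 <= inf_cost p f g)%E.
Proof.
by apply: le_ereal_inf_tmp => _ [pi [pi0 _ _] <-]; exact: transport_cost_ge0.
Qed.

Lemma inf_cost_sym (R : realType) (p : R) (f g : nat -> R) :
  inf_cost p f g =
  inf_cost p g f.
Proof.
congr ereal_inf; apply/seteqP; split => _ [pi cpi <-];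
  (exists (fun i j => pi j i); first exact: couplings_sym);
  by apply: transport_cost_sym; case: cpi.
Qed.

Lemma toscani_sym (R : realType) (s : R) (f g : nat -> R) :
  toscani s f g = toscani s g f.
Proof.
by congr ereal_sup; apply/seteqP; split => _ [z z01 <-]; exists z => //;
  rewrite distrC.
Qed.

(** * Expectations of nonnegative functions and integration against a coupling *)

Section Expect.
Context {R : realType}.
Implicit Types (f g u v : nat -> R).

Lemma expect_ge0 f u : (forall n, 0 <= f n) -> (forall n, 0 <= u n) ->
  (0 <= expect f u)%E.
Proof.
by move=> f0 u0; apply: nneseries_ge0 => n _ _; rewrite lee_fin mulr_ge0.
Qed.

Lemma expect0 f : expect f (fun=> 0) = 0%E.
Proof. by apply: eseries0 => n _ _; rewrite mul0r. Qed.

Lemma expectD f u v : (forall n, 0 <= f n) -> (forall n, 0 <= u n) ->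
  (forall n, 0 <= v n) ->
  expect f (fun n => u n + v n) = (expect f u + expect f v)%E.
Proof.
move=> f0 u0 v0; rewrite /expect -nneseriesD; last 2 first.
- by move=> n _ _; rewrite lee_fin mulr_ge0.
- by move=> n _ _; rewrite lee_fin mulr_ge0.
by apply: eq_eseriesr => n _; rewrite mulrDl EFinD.
Qed.

Lemma expectZ f u (c : R) : (forall n, 0 <= f n) -> (forall n, 0 <= u n) ->
  expect f (fun n => c * u n) = (c%:E * expect f u)%E.
Proof.
move=> f0 u0; rewrite /expect -nneseriesZl; last first.
  by move=> n _; rewrite lee_fin mulr_ge0.
by apply: eq_eseriesr => n _; rewrite -mulrA EFinM.
Qed.

Lemma le_expect f u v : (forall n, 0 <= f n) -> (forall n, 0 <= u n) ->
  (forall n, u n <= v n) -> (expect f u <= expect f v)%E.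
Proof.
move=> f0 u0 uv; apply: lee_nneseries => n _.
  by move=> _; rewrite lee_fin mulr_ge0.
by rewrite lee_fin ler_wpM2r.
Qed.

Lemma moment1E f : moment 1 f = expect f (fun n => n%:R).
Proof. by apply: eq_eseriesr => n _; rewrite powRr1. Qed.

Lemma moment2E f : moment 2 f = expect f (fun n => n%:R ^+ 2).
Proof. by apply: eq_eseriesr => n _; rewrite powR_mulrn. Qed.

(** The partial sums increase and stay below the total mass 1, so the real limit in [pgf] is a
    genuine one and agrees with the extended sum. *)
Lemma pgfE f (z : R) : distrN f -> 0 < z < 1 ->
  (pgf f z)%:E = expect f (fun n => z ^+ n).
Proof.
move=> [f0 f1] /andP[z0 z1].
have nn n : 0 <= z ^+ n * f n by rewrite mulr_ge0 ?exprn_ge0// ltW.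
have fle1 n : \sum_(0 <= k < n) z ^+ k * f k <= 1.
  rewrite -lee_fin -f1 -sumEFin; apply: le_trans; last first.
    by apply: (nneseries_lim_ge n) => k _ _; rewrite lee_fin.
  apply: lee_sum => k _; rewrite lee_fin ler_piMl// exprn_ile1//; lra.
rewrite /pgf -EFin_lim; last first.
  apply: nondecreasing_is_cvgn.
    by apply/nondecreasing_seqP => n; rewrite /series/= big_nat_recr//= lerDl.
  by exists 1 => _ [n _ <-]; exact: fle1.
by congr (limn _); apply/funext => n /=; rewrite /series/= sumEFin.
Qed.

Lemma coupling_expectl f g u (pi : nat -> nat -> R) : couplings f g pi ->
  (forall n, 0 <= u n) ->
  (\sum_(0 <= i <oo) \sum_(0 <= j <oo) (pi i j * u i)%:E = expect f u)%E.
Proof.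
move=> [pi0 fE _] u0; apply: eq_eseriesr => i _.
rewrite EFinM -fE -nneseriesZl; last by move=> j _; rewrite lee_fin.
by apply: eq_eseriesr => j _; rewrite mulrC EFinM.
Qed.

Lemma coupling_expectr f g u (pi : nat -> nat -> R) : couplings f g pi ->
  (forall n, 0 <= u n) ->
  (\sum_(0 <= i <oo) \sum_(0 <= j <oo) (pi i j * u j)%:E = expect g u)%E.
Proof.
move=> cpi u0; rewrite nneseries_interchange; last first.
  by move=> i j; rewrite lee_fin mulr_ge0//; case: cpi.
exact: (coupling_expectl (couplings_sym cpi) u0).
Qed.

(* The easy half of Kantorovich duality, in subtraction-free form so that all
   the sums may be infinite. *)
Lemma transport_le (p c : R) f g u v u' v' (pi : nat -> nat -> R) :
  couplings f g pi -> 0 <= c ->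
  (forall n, 0 <= u n) -> (forall n, 0 <= v n) ->
  (forall n, 0 <= u' n) -> (forall n, 0 <= v' n) ->
  (forall i j, u i + v j <= u' i + v' j + c * `|i%:R - j%:R| `^ p) ->
  (expect f u + expect g v <=
   expect f u' + expect g v' + c%:E * transport_cost p pi)%E.
Proof.
move=> cpi c0 u0 v0 u'0 v'0 uv; have [pi0 _ _] := cpi.
have dsumD (a b : nat -> nat -> R) : (forall i j, 0 <= a i j) ->
    (forall i j, 0 <= b i j) ->
    (\sum_(0 <= i <oo) \sum_(0 <= j <oo) (a i j + b i j)%:E =
     \sum_(0 <= i <oo) \sum_(0 <= j <oo) (a i j)%:E +
     \sum_(0 <= i <oo) \sum_(0 <= j <oo) (b i j)%:E)%E.
  move=> a0 b0; rewrite -nneseriesD; last 2 first.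
  - by move=> i _ _; apply: nneseries_ge0 => j _ _; rewrite lee_fin.
  - by move=> i _ _; apply: nneseries_ge0 => j _ _; rewrite lee_fin.
  apply: eq_eseriesr => i _; rewrite -nneseriesD//.
  - by move=> j _ _; rewrite lee_fin.
  - by move=> j _ _; rewrite lee_fin.
have -> : (c%:E * transport_cost p pi = \sum_(0 <= i <oo) \sum_(0 <= j <oo)
    (pi i j * (c * `|i%:R - j%:R| `^ p))%:E)%E.
  rewrite -nneseriesZl; last first.
    move=> i _; apply: nneseries_ge0 => j _ _.
    by rewrite lee_fin mulr_ge0 ?powR_ge0.
  apply: eq_eseriesr => i _; rewrite -nneseriesZl; last first.
    by move=> j _; rewrite lee_fin mulr_ge0 ?powR_ge0.
  by apply: eq_eseriesr => j _; rewrite -EFinM mulrCA.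
(* The marginals turn every expectation into a double sum against [pi]; what remains is an entrywise
   comparison. *)
rewrite -!(coupling_expectl cpi)// -!(coupling_expectr cpi)//.
have pm (w : nat -> nat -> R) : (forall i j, 0 <= w i j) ->
  forall i j, 0 <= pi i j * w i j by move=> w0 i j; rewrite mulr_ge0.
have cp0 i j : 0 <= c * `|i%:R - j%:R| `^ p by rewrite mulr_ge0 ?powR_ge0.
rewrite -!dsumD//; try (by move=> i j; rewrite ?addr_ge0 ?mulr_ge0).
apply: lee_nneseries => i _.
  by move=> _; apply: nneseries_ge0 => j _ _; rewrite lee_fin addr_ge0 ?mulr_ge0.
apply: lee_nneseries => j _.
  by move=> _; rewrite lee_fin addr_ge0 ?mulr_ge0.
by rewrite lee_fin -!mulrDr ler_wpM2l.
Qed.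

End Expect.

(** Passes from each coupling to the infimum. With [x], [y] real and [c] positive, the inequality
    can be solved for the cost, even when the cost is infinite. *)
Lemma le_inf_cost (R : realType) (p : R) (f g : nat -> R) (x y c : R) : 0 < c ->
  (forall pi, couplings f g pi ->
     (x%:E <= y%:E + c%:E * transport_cost p pi)%E) ->
  (x%:E <= y%:E + c%:E * inf_cost p f g)%E.
Proof.
move=> c0 H.
have : (((x - y) / c)%:E <= inf_cost p f g)%E.
  apply: le_ereal_inf_tmp => _ [pi cpi <-]; have pi0 : forall i j, 0 <= pi i j.
    by case: cpi.
  move: (H pi cpi) (transport_cost_ge0 p pi0).
  move: (transport_cost p pi) => [k| |] //; last by move=> _ _; rewrite leey.
  by rewrite -EFinM -EFinD !lee_fin => + _; rewrite ler_pdivrMr// mulrC; lra.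
move: (inf_cost p f g) => [k| |] //.
- by rewrite -EFinM -EFinD !lee_fin ler_pdivrMr// mulrC; lra.
- by move=> _; rewrite gt0_muley ?lte_fin// addey// leey.
Qed.

(** * Increments of powers and of linearly tilted powers *)

Section PowerIncrements.
Context {R : realType} (z : R).

Lemma one_sub_pow_ge0 (z_gt0 : 0 < z) (z_lt1 : z < 1) n : 0 <= 1 - z ^+ n.
Proof. by rewrite subr_ge0 exprn_ile1//; lra. Qed.

Lemma one_sub_pow_le (z_gt0 : 0 < z) (z_lt1 : z < 1) n :
  1 - z ^+ n <= n%:R * (1 - z).
Proof.
elim: n => [|n IH]; first by rewrite expr0 subrr mul0r.
have : 0 <= (1 - z) * (1 - z ^+ n).
  by rewrite mulr_ge0 ?one_sub_pow_ge0//; lra.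
by rewrite exprS -natr1; lra.
Qed.

(** For i <= j, factor out z^i <= 1 and apply the Bernoulli-type bound to 1 - z^(j-i); otherwise the
    left side is at most 0. *)
Lemma pow_diff_le (z_gt0 : 0 < z) (z_lt1 : z < 1) i j :
  z ^+ i - z ^+ j <= (1 - z) * `|i%:R - j%:R|.
Proof.
have zn n : 0 <= z ^+ n <= 1.
  by rewrite exprn_ge0 ?exprn_ile1//; lra.
have [ij|/ltnW ji] := leqP i j.
  rewrite distrC -natrB// ger0_norm// -{1}(subnKC ij) exprD.
  apply: le_trans (_ : 1 - z ^+ (j - i) <= _); last first.
    by rewrite mulrC (one_sub_pow_le z_gt0 z_lt1).
  have := one_sub_pow_ge0 z_gt0 z_lt1 (j - i); have := zn i; nra.
apply: (@le_trans _ _ 0); last by rewrite mulr_ge0//; lra.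
rewrite -{1}(subnKC ji) exprD.
have := zn j; have := one_sub_pow_ge0 z_gt0 z_lt1 (i - j); nra.
Qed.

Let h n := z ^+ n + (1 - z) * n%:R.

(** Telescoping: the step from i+l to i+l+1 costs at most (1-z)^2 (i+l), and the sum of i+l over l <
    k is at most k i + k^2 / 2. *)
Lemma tilted_pow_shift (z_gt0 : 0 < z) (z_lt1 : z < 1) i k :
  0 <= h (i + k) - h i <= (1 - z) ^+ 2 * (k%:R * i%:R + k%:R ^+ 2 / 2).
Proof.
elim: k => [|k IH]; first by rewrite addn0 subrr; nra.
have step : h (i + k.+1) - h (i + k) = (1 - z) * (1 - z ^+ (i + k)).
  by rewrite /h addnS exprS -natr1; ring.
have -> : h (i + k.+1) - h i =
    (h (i + k) - h i) + (1 - z) * (1 - z ^+ (i + k)) by rewrite -step; ring.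
have := one_sub_pow_le z_gt0 z_lt1 (i + k); have := one_sub_pow_ge0 z_gt0 z_lt1 (i + k).
rewrite -natr1 natrD; move: (z ^+ _) (h _ - h _) IH => a b IH a0 a1.
have q0 : 0 < 1 - z by lra.
have : (1 - z) * (1 - a) <= (1 - z) ^+ 2 * (i%:R + k%:R).
  by rewrite expr2 -mulrA ler_pM2l// mulrC.
have : 0 <= (1 - z) * (1 - a) by rewrite mulr_ge0// ltW.
have : 0 <= (1 - z) ^+ 2 by rewrite sqr_ge0.
case/andP: IH => b0; move: (_ ^+ 2) (_ * (1 - a)) b0 => q c b0 b1 Q0 c0 c1.
by apply/andP; split; lra.
Qed.

(** The shift bound carries the smaller index as a factor. Replacing it by [i] in both cases ensures
    that only the second moment of the first marginal enters later. *)
Lemma tilted_pow_diff_le (z_gt0 : 0 < z) (z_lt1 : z < 1) i j :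
  `|h i - h j| <= (1 - z) ^+ 2 *
    (`|i%:R - j%:R| * i%:R + `|i%:R - j%:R| ^+ 2 / 2).
Proof.
have q0 : 0 <= (1 - z) ^+ 2 by rewrite sqr_ge0.
have [ij|/ltnW ji] := leqP i j.
  have := tilted_pow_shift z_gt0 z_lt1 i (j - i); rewrite subnKC// => /andP[h0 h1].
  by rewrite distrC ger0_norm// distrC -natrB// normr_nat.
have := tilted_pow_shift z_gt0 z_lt1 j (i - j); rewrite subnKC// => /andP[h0 h1].
rewrite ger0_norm// -natrB// normr_nat; apply: (le_trans h1).
by rewrite ler_wpM2l// lerD2r ler_wpM2l// ler_nat.
Qed.

(* AM-GM with parameter t: i d <= t i^2 / 2 + d^2 / (2 t). *)
Lemma tilted_pow_diff_amgm (z_gt0 : 0 < z) (z_lt1 : z < 1) (t : R) i j : 0 < t ->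
  `|h i - h j| <= (1 - z) ^+ 2 * (t / 2) * i%:R ^+ 2 +
    (1 - z) ^+ 2 * (1 / 2 + 1 / (2 * t)) * `|i%:R - j%:R| `^ 2.
Proof.
move=> t0; apply: (le_trans (tilted_pow_diff_le z_gt0 z_lt1 i j)).
rewrite powR_mulrn//; move: (i%:R : R) `|_ - _| => x d.
have -> (a b : R) : (1 - z) ^+ 2 * a * x ^+ 2 + (1 - z) ^+ 2 * b * d ^+ 2 =
    (1 - z) ^+ 2 * (a * x ^+ 2 + b * d ^+ 2) by ring.
rewrite ler_wpM2l ?sqr_ge0//.
rewrite -subr_ge0.
(* Completing the square. *)
have -> : t / 2 * x ^+ 2 + (1 / 2 + 1 / (2 * t)) * d ^+ 2 -
    (d * x + d ^+ 2 / 2) = (t * x - d) ^+ 2 / (2 * t) by field; lra.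
by rewrite divr_ge0 ?sqr_ge0//; lra.
Qed.

End PowerIncrements.

(** * Bounding the Toscani distances by transport costs *)

Section Upper.
Context {R : realType}.
Implicit Types (f g : nat -> R).

Lemma pgf_gap1 (p : R) f g pi (z : R) : 1 <= p -> distrN f -> distrN g ->
  couplings f g pi -> 0 < z < 1 ->
  ((pgf f z)%:E <= (pgf g z)%:E + (1 - z)%:E * transport_cost p pi)%E.
Proof.
move=> p1 df dg cpi z01; rewrite !pgfE//.
have [z_gt0 z_lt1] := andP z01.
have z0 n : 0 <= z ^+ n by rewrite exprn_ge0//; lra.
have := transport_le (p := p) (c := 1 - z) (u := fun n => z ^+ n) (v := fun=> 0)
  (u' := fun=> 0) (v' := fun n => z ^+ n) cpi.
rewrite !expect0 adde0 add0e; apply=> //; first lra.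
move=> i j; rewrite addr0 add0r -lerBlDl.
apply: (le_trans (pow_diff_le z_gt0 z_lt1 i j)); rewrite ler_wpM2l//; first lra.
(* Distinct integers are at distance at least 1, so raising the distance to a power p >= 1 does not
   decrease it. *)
have [->|ij] := eqVneq i j; first by rewrite subrr normr0 powR_ge0.
rewrite -[leLHS]powRr1// ler_powR//.
have -> : i%:R - j%:R = (i%:Z - j%:Z)%:~R :> R by rewrite intrB.
by rewrite -intr_norm (ler_int _ 1) -gtz0_ge1 normr_gt0 subr_eq0.
Qed.

(** Part (i) is p = 1. The case p = 2 shows that a vanishing quadratic cost forces equal generating
    functions, which settles a degenerate case of part (ii). *)
Lemma toscani1_le_inf_cost (p : R) f g : 1 <= p -> distrN f -> distrN g ->
  (toscani 1 f g <= inf_cost p f g)%E.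
Proof.
move=> p1 df dg; apply: ge_ereal_sup => _ [z /= z01 <-].
have [z_gt0 z_lt1] := andP z01.
have q0 : 0 < 1 - z by lra.
have := le_inf_cost q0 (fun pi cpi => pgf_gap1 p1 df dg cpi z01).
have := le_inf_cost q0 (fun pi cpi => pgf_gap1 p1 dg df cpi z01).
rewrite powRr1 ?normr_ge0// [`|1 - z|]gtr0_norm// (inf_cost_sym p g f).
have := inf_cost_ge0 p f g; move: (inf_cost p f g) => [k| |] // _; last by rewrite leey.
rewrite -EFinM -!EFinD !lee_fin ler_pdivrMr// ler_norml => a b.
by apply/andP; split; lra.
Qed.

Lemma pgf_gap2 f g (m r z t : R) : distrN f -> distrN g ->
  moment 1 f = moment 1 g -> moment 2 f = m%:E ->
  inf_cost 2 f g = r%:E ->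
  0 < z < 1 -> 0 < t ->
  `|pgf f z - pgf g z| <=
    (1 - z) ^+ 2 * (t / 2 * m + (1 / 2 + 1 / (2 * t)) * r).
Proof.
move=> df dg fg1 f2 infE z01 t0.
have [[f0 _] [g0 _]] := (df, dg).
have [z_gt0 z_lt1] := andP z01.
have z0 n : 0 <= z ^+ n by rewrite exprn_ge0//; lra.
have q0 : 0 < 1 - z by lra.
(* Since n <= n^2 on integers, the mean is finite, so the tilt (1-z) M can be cancelled from both
   sides. *)
have [M f1E] : exists M, moment 1 f = M%:E.
  have := expect_ge0 f0 (fun n => ler0n R n).
  have := le_expect (u := fun n => n%:R) (v := fun n => n%:R ^+ 2) f0
    (fun n => ler0n R n).
  rewrite -moment1E -moment2E f2; move: (moment 1 f) => [M| |] //.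
    by exists M.
  move=> /(_ _)/wrap[]// n; rewrite -natrX ler_nat.
  by case: n => // n; rewrite expnS expn1 leq_pmulr.
have n0 n : 0 <= (1 - z) * n%:R :> R by rewrite mulr_ge0// ltW.
have tiltE k : distrN k -> moment 1 k = M%:E ->
    expect k (fun n => z ^+ n + (1 - z) * n%:R) = (pgf k z + (1 - z) * M)%:E.
  move=> dk k1; have k0 : forall n, 0 <= k n by case: dk.
  by rewrite expectD// expectZ// -moment1E k1 -pgfE.
pose b := (1 - z) ^+ 2 * (t / 2); pose c := (1 - z) ^+ 2 * (1 / 2 + 1 / (2 * t)).
have c0 : 0 < c.
  by rewrite mulr_gt0 ?exprn_gt0// addr_gt0// divr_gt0//; lra.
have b0 : 0 < b by rewrite mulr_gt0 ?exprn_gt0//; lra.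
have h0 n : 0 <= z ^+ n + (1 - z) * n%:R by rewrite addr_ge0.
have bn0 n : 0 <= b * n%:R ^+ 2 by rewrite mulr_ge0 ?exprn_ge0// ltW.
have bE : expect f (fun n => b * n%:R ^+ 2) = (b * m)%:E.
  by rewrite expectZ -?moment2E ?f2// => n; rewrite exprn_ge0.
have up : pgf f z <= pgf g z + b * m + c * r.
  rewrite -lee_fin [X in (_ <= X)%E]EFinD [(c * r)%:E]EFinM -infE.
  apply: le_inf_cost => // pi cpi.
  have := transport_le (p := 2) (c := c) (u := fun n => z ^+ n + (1 - z) * n%:R)
    (v := fun=> 0) (u' := fun n => b * n%:R ^+ 2)
    (v' := fun n => z ^+ n + (1 - z) * n%:R) cpi (ltW c0) h0 _ bn0 h0.
  rewrite expect0 !tiltE ?bE -?fg1// adde0 => /(_ _ _)/wrap[]//.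
    move=> i j; have := tilted_pow_diff_amgm z_gt0 z_lt1 i j t0.
    by rewrite ler_norml -/b -/c => /andP[_]; lra.
  move: (transport_cost_ge0 2 (let: And3 x _ _ := cpi in x)).
  move: (transport_cost 2 pi) => [k| |] //.
    by rewrite -EFinM -!EFinD !lee_fin; lra.
  by rewrite gt0_muley ?lte_fin// !addey// !leey.
(* In this direction too the quadratic slack is charged to [f], as no bound on the second moment of
   [g] is assumed; it joins the tilted power in [u']. *)
have lo : pgf g z <= pgf f z + b * m + c * r.
  rewrite -lee_fin [X in (_ <= X)%E]EFinD [(c * r)%:E]EFinM -infE.
  apply: le_inf_cost => // pi cpi.
  have := transport_le (p := 2) (c := c) (v := fun n => z ^+ n + (1 - z) * n%:R)
    (u := fun=> 0) (u' := fun n => (z ^+ n + (1 - z) * n%:R) + b * n%:R ^+ 2)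
    (v' := fun=> 0) cpi (ltW c0) _ h0 _ _.
  rewrite !expect0 [expect f _]expectD// !tiltE ?bE -?fg1// adde0 add0e.
  move=> /(_ _ _ _ _)/wrap[]//.
  - by move=> n; rewrite addr_ge0.
  - move=> i j; have := tilted_pow_diff_amgm z_gt0 z_lt1 i j t0.
    by rewrite ler_norml -/b -/c => /andP[+ _]; lra.
  move: (transport_cost_ge0 2 (let: And3 x _ _ := cpi in x)).
  move: (transport_cost 2 pi) => [k| |] //.
    by rewrite -EFinM -!EFinD !lee_fin; lra.
  by rewrite gt0_muley ?lte_fin// !addey// !leey.
have -> : (1 - z) ^+ 2 * (t / 2 * m + (1 / 2 + 1 / (2 * t)) * r) = b * m + c * r.
  by rewrite /b /c; field; rewrite gt_eqF.
by rewrite ler_norml; apply/andP; split; lra.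
Qed.

(** The optimal weight is t = sqrt r / sqrt m, which may be 0 or undefined. Both roots are therefore
    shifted by a small [e'], at a cost of at most [e]. *)
Lemma le_sqrt_mul (x m r : R) : 0 <= m -> 0 <= r ->
  (forall t, 0 < t -> x <= t / 2 * m + 1 / (2 * t) * r) ->
  x <= Num.sqrt m * Num.sqrt r.
Proof.
move=> m0 r0 H; have := sqr_sqrtr m0; have := sqr_sqrtr r0.
have := sqrtr_ge0 m; have := sqrtr_ge0 r.
move: (Num.sqrt m) (Num.sqrt r) => q s s0 q0 sE qE.
apply/ler_addgt0Pr => e e0.
pose e' := e / (q + s + 1).
have d0 : 0 < q + s + 1 by lra.
have e'0 : 0 < e' by rewrite divr_gt0.
have e'E : e = e' * (q + s + 1) by rewrite /e' divfK// gt_eqF.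
have t0 : 0 < (s + e') / (q + e') by rewrite divr_gt0//; lra.
apply: (le_trans (H _ t0)); rewrite -qE -sE e'E.
have k1 : q ^+ 2 / (q + e') <= q.
  by rewrite ler_pdivrMr; [nra|lra].
have k2 : s ^+ 2 / (s + e') <= s.
  by rewrite ler_pdivrMr; [nra|lra].
have -> : (s + e') / (q + e') / 2 * q ^+ 2 + 1 / (2 * ((s + e') / (q + e'))) * s ^+ 2 =
    (s + e') / 2 * (q ^+ 2 / (q + e')) + (q + e') / 2 * (s ^+ 2 / (s + e')).
  by field; rewrite !gt_eqF//; lra.
apply: (@le_trans _ _ ((s + e') / 2 * q + (q + e') / 2 * s)); last by nra.
by rewrite lerD// ler_wpM2l//; lra.
Qed.

Lemma toscani2_le f g (m r : R) : distrN f -> distrN g ->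
  moment 1 f = moment 1 g -> moment 2 f = m%:E ->
  inf_cost 2 f g = r%:E ->
  (toscani 2 f g <= (1 / 2 * r + Num.sqrt m * Num.sqrt r)%:E)%E.
Proof.
move=> df dg fg1 f2 infE; apply: ge_ereal_sup => _ [z /= z01 <-].
have [z_gt0 z_lt1] := andP z01.
have q0 : 0 < 1 - z by lra.
rewrite lee_fin powR_mulrn ?normr_ge0// real_normK ?num_real//.
rewrite -lerBlDl; apply: le_sqrt_mul.
- rewrite -lee_fin -f2 moment2E; apply: expect_ge0; first by case: df.
  by move=> n; rewrite exprn_ge0.
- by rewrite -lee_fin -infE inf_cost_ge0.
- move=> t t0; rewrite lerBlDl ler_pdivrMr ?exprn_gt0//.
  apply: (le_trans (pgf_gap2 df dg fg1 f2 infE z01 t0)).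
  by rewrite mulrC ler_wpM2r ?sqr_ge0// mulrDl; lra.
Qed.

Lemma wasserstein2_sqr f g : (wasserstein 2 f g ^+ 2 =
  inf_cost 2 f g)%E.
Proof.
rewrite wassersteinE; have := inf_cost_ge0 2 f g.
move: (inf_cost 2 f g) => [r| |] //.
  by rewrite lee_fin => r0; rewrite poweR_EFin -EFin_expe powR12_sqrt// sqr_sqrtr.
by rewrite poweRyr// expe2 mulyy.
Qed.

Lemma toscani1_le_wasserstein1 f g : distrN f -> distrN g ->
  (toscani 1 f g <= wasserstein 1 f g)%E.
Proof.
move=> df dg; rewrite wassersteinE invr1 poweRe1 ?inf_cost_ge0//.
exact: toscani1_le_inf_cost.
Qed.

Lemma toscani2_le_wasserstein2 f g : distrN f -> distrN g ->
  moment 1 f = moment 1 g ->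
  (toscani 2 f g <= (2^-1)%:E * wasserstein 2 f g ^+ 2
     + mine (moment 2 f) (moment 2 g) `^ 2^-1 * wasserstein 2 f g)%E.
Proof.
move=> df dg fg1.
have mom0 (k : nat -> R) : distrN k -> (0 <= moment 2 k)%E.
  by move=> [k0 _]; rewrite moment2E; apply: expect_ge0 => // n; rewrite exprn_ge0.
(* Both sides are symmetric in [f] and [g], so the minimum may be taken at [f]. *)
wlog fg2 : f g df dg fg1 / (moment 2 f <= moment 2 g)%E.
  move=> H; have [|gf2] := orP (le_total (moment 2 f) (moment 2 g)); first exact: H.
  have := H g f dg df (esym fg1) gf2.
  by rewrite toscani_sym !wassersteinE inf_cost_sym minC.
rewrite (min_idPl fg2) wasserstein2_sqr wassersteinE.
have := inf_cost_ge0 2 f g.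
case infE : (inf_cost 2 f g) => [r| |] //; last first.
  move=> _; rewrite gt0_muley ?lte_fin ?invr_gt0// addye ?leey//.
  by rewrite gt_eqF// (lt_le_trans (ltNyr 0))// mule_ge0 ?poweR_ge0.
rewrite lee_fin => r0; rewrite poweR_EFin powR12_sqrt//.
have := mom0 _ df; case f2 : (moment 2 f) => [m| |] // m0.
  rewrite poweR_EFin powR12_sqrt// -!EFinM -EFinD -div1r.
  exact: toscani2_le.
(* Here the minimum of the second moments is infinite. A positive cost makes the right side +oo; for
   zero cost the convention 0 * oo = 0 makes it 0, so D_2 itself must be shown to vanish. *)
have [rE|rN0] := eqVneq r 0; last first.
  have r1 : 0 < r by rewrite lt_neqAle eq_sym rN0.
  by rewrite poweRyr ?invr_eq0 ?pnatr_eq0// gt0_mulye ?lte_fin ?sqrtr_gt0// addey// leey.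
rewrite rE sqrtr0 !mule0 adde0; apply: ge_ereal_sup => _ [z /= z01 <-].
have [z_gt0 z_lt1] := andP z01.
have : ((`|pgf f z - pgf g z| / `|1 - z| `^ 1)%:E <= 0%:E :> \bar R)%E.
  rewrite -rE -infE; apply: le_trans (toscani1_le_inf_cost _ df dg); last by lra.
  by apply: ereal_sup_ubound; exists z.
have q0 : 0 < 1 - z by lra.
rewrite !lee_fin powRr1// pmulr_lle0 ?invr_gt0 ?normr_gt0 ?gt_eqF//.
by rewrite normr_le0 => /eqP ->; rewrite normr0 mul0r.
Qed.

End Upper.

Lemma nneseries_finite (R : realType) (F : nat -> \bar R) (N : nat) :
  (forall n, (0 <= F n)%E) -> (forall n, (N < n)%N -> F n = 0%E) ->
  (\sum_(0 <= n <oo) F n = \sum_(n < N.+1) F n)%E.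
Proof.
move=> F0 FN; rewrite (nneseries_split 0 N.+1)// add0n big_mkord.
by rewrite [X in (_ + X)%E]eseries0 ?adde0// => n /FN.
Qed.

(** * Recovering polynomial coefficients from values in (0, 1) *)

Section Interpolation.
Context {R : realType} (N : nat).

(** The shifts by 1 and 2 keep the N + 1 nodes off both endpoints 0 and 1. *)
Let node (k : 'I_N.+1) : R := k.+1%:R / N.+2%:R.

Let V : 'M[R]_N.+1 := Vandermonde N.+1 (\row_k node k).

(** The constant K_N: the entrywise l^1 norm of the inverse Vandermonde matrix, which bounds its
    operator norm from sup norm to l^1. *)
Definition interp_const : R := \sum_i \sum_k `|invmx V k i|.

Lemma interp_const_ge0 : 0 <= interp_const.
Proof. by do 2!apply: sumr_ge0 => ? _. Qed.

Let V_unit : V \in unitmx.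
Proof.
rewrite unitmxE unitfE det_Vandermonde; apply/prodf_neq0 => i _.
apply/prodf_neq0 => j ij; rewrite !mxE subr_eq0 /node.
rewrite (inj_eq (mulIf _)) ?invr_eq0 ?pnatr_eq0//.
by rewrite eqr_nat eqSS gt_eqF.
Qed.

(* The coefficients are recovered from the values at N + 1 points of (0, 1) by
   the inverse Vandermonde matrix. *)
Lemma sum_coef_le (c : nat -> R) (D : R) :
  (forall z, 0 < z < 1 -> `|\sum_(n < N.+1) z ^+ n * c n| <= D) ->
  \sum_(n < N.+1) `|c n| <= interp_const * D.
Proof.
move=> cD; rewrite mulr_suml; apply: ler_sum => i _.
have node01 k : 0 < node k < 1.
  by rewrite /node divr_gt0// ltr_pdivrMr// mul1r ltr_nat ltnS ltn_ord.
pose r : 'rV[R]_N.+1 := \row_n c n.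
have -> : c i = \sum_k (r *m V) 0 k * invmx V k i.
  by have := mulmxK V_unit r => /(congr1 (fun A : 'rV_N.+1 => A 0 i)); rewrite !mxE.
apply: (le_trans (ler_norm_sum _ _ _)); rewrite mulr_suml.
apply: ler_sum => k _; rewrite normrM mulrC ler_wpM2l//.
rewrite !mxE; apply: le_trans (cD _ (node01 k)).
by rewrite le_eqVlt; apply/orP; left; apply/eqP; congr (`|_|);
  apply: eq_bigr => n _; rewrite !mxE mulrC.
Qed.

End Interpolation.

(** * Finite supports: the overlap coupling and the reverse estimate *)

Section FiniteSupport.
Context {R : realType} (N : nat).
Implicit Types (f g : nat -> R).

Lemma distrN_finite f : distrN f -> supp f `<=` [set n | (n <= N)%N] ->
  (forall n, (N < n)%N -> f n = 0) /\ \sum_(n < N.+1) f n = 1.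
Proof.
move=> [f0 f1] fN.
have fz n : (N < n)%N -> f n = 0.
  move=> Nn; apply/eqP; rewrite eq_le f0 andbT leNgt; apply/negP => /fN /=.
  by rewrite leqNgt Nn.
split=> //; apply: EFin_inj; rewrite -f1 -sumEFin; apply/esym/nneseries_finite.
  by move=> n; rewrite lee_fin.
by move=> n /fz ->.
Qed.

Lemma pgf_finite f (z : R) : distrN f -> (forall n, (N < n)%N -> f n = 0) ->
  0 < z < 1 -> pgf f z = \sum_(n < N.+1) z ^+ n * f n.
Proof.
move=> df fN z01; have [z0 _] := andP z01; have [f0 _] := df.
apply: EFin_inj; rewrite pgfE// -sumEFin; apply: nneseries_finite => n.
  by rewrite lee_fin mulr_ge0// exprn_ge0// ltW.
by move=> /fN ->; rewrite mulr0.
Qed.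

Definition excess f g (n : nat) : R := Num.max (f n - g n) 0.

(** For two probability distributions on {0, ..., N}, this is their total variation distance. *)
Definition excess_mass f g : R := \sum_(n < N.+1) excess f g n.

(* Leaves the common mass in place and spreads the excess of f over that of g
   independently; when the excess mass is 0, both excesses vanish and so does
   the junk quotient. *)
Definition overlap_coupling f g (i j : nat) : R :=
  (i == j)%:R * Num.min (f i) (g i) +
  excess f g i * excess g f j / excess_mass f g.

Lemma excess_ge0 f g n : 0 <= excess f g n.
Proof. by rewrite le_max lexx orbT. Qed.

Lemma excess_le f g n : 0 <= f n -> 0 <= g n -> excess f g n <= f n.
Proof. by move=> f0 g0; rewrite ge_max f0 lerBlDr lerDl g0. Qed.

Lemma excess_le_norm f g n : excess f g n <= `|f n - g n|.
Proof. by rewrite ge_max ler_norm normr_ge0. Qed.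

Lemma excess_mass_ge0 f g : 0 <= excess_mass f g.
Proof. by apply: sumr_ge0 => n _; exact: excess_ge0. Qed.

Lemma min_add_excess f g n : Num.min (f n) (g n) + excess f g n = f n.
Proof. by rewrite /excess; case: (leP (f n) (g n)) => h; case: leP => k; lra. Qed.

(** The positive parts of f - g and of g - f differ by f - g, which sums to 0. *)
Lemma excess_mass_sym f g :
  \sum_(n < N.+1) f n = \sum_(n < N.+1) g n ->
  excess_mass f g = excess_mass g f.
Proof.
move=> fg; apply/eqP; rewrite -subr_eq0 -sumrB.
rewrite (eq_bigr (fun n : 'I_N.+1 => f n - g n)); last first.
  move=> n _; have := min_add_excess f g n; have := min_add_excess g f n.
  by rewrite minC; lra.
by rewrite sumrB fg subrr.
Qed.

Lemma overlap_coupling_sym f g i j :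
  \sum_(n < N.+1) f n = \sum_(n < N.+1) g n ->
  overlap_coupling f g i j = overlap_coupling g f j i.
Proof.
move=> fg; rewrite /overlap_coupling excess_mass_sym// [_ * excess g f j]mulrC.
by have [->|_] := eqVneq i j; [rewrite minC|rewrite !mul0r].
Qed.

Lemma overlap_coupling_ge0 f g i j : (forall n, 0 <= f n) ->
  (forall n, 0 <= g n) -> 0 <= overlap_coupling f g i j.
Proof.
move=> f0 g0; rewrite addr_ge0// ?mulr_ge0 ?invr_ge0 ?excess_ge0//.
- by rewrite le_min f0 g0.
- exact: excess_mass_ge0.
Qed.

Lemma excess_out f g n : (forall n, (N < n)%N -> f n = 0) ->
  (forall n, 0 <= g n) -> (N < n)%N -> excess f g n = 0.
Proof. by move=> fN g0 Nn; apply/max_idPr; rewrite fN// sub0r oppr_le0. Qed.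

Lemma overlap_coupling_out f g i j : (forall n, 0 <= f n) ->
  (forall n, (N < n)%N -> f n = 0) -> (forall n, (N < n)%N -> g n = 0) ->
  (N < j)%N -> overlap_coupling f g i j = 0.
Proof.
move=> f0 fN gN Nj; rewrite /overlap_coupling (@excess_out g f)//.
rewrite mulr0 mul0r addr0.
by have [->|] := eqVneq i j; rewrite ?mul0r// mul1r fN// gN// minxx.
Qed.

Lemma overlap_coupling_row f g i : (forall n, 0 <= f n) ->
  (forall n, 0 <= g n) ->
  (forall n, (N < n)%N -> f n = 0) -> (forall n, (N < n)%N -> g n = 0) ->
  \sum_(n < N.+1) f n = \sum_(n < N.+1) g n ->
  (\sum_(0 <= j <oo) (overlap_coupling f g i j)%:E = (f i)%:E)%E.
Proof.
move=> f0 g0 fN gN fg; rewrite (@nneseries_finite _ _ N); last 2 first.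
- by move=> j; rewrite lee_fin overlap_coupling_ge0.
- by move=> j Nj; rewrite overlap_coupling_out.
rewrite sumEFin; congr EFin; rewrite big_split/=.
have -> : \sum_(j < N.+1) excess f g i * excess g f j / excess_mass f g =
    excess f g i * excess_mass f g / excess_mass f g.
  by rewrite -mulr_suml -mulr_sumr {2}(excess_mass_sym fg).
have -> : \sum_(j < N.+1) (i == j)%:R * Num.min (f i) (g i) =
    Num.min (f i) (g i).
  have [iN|Ni] := leqP i N; last first.
    by rewrite fN// gN// minxx big1// => j _; rewrite mulr0.
  rewrite (bigD1 (Ordinal (iN : (i < N.+1)%N)))//= eqxx mul1r big1 ?addr0//.
  by move=> j /negP ji; case: eqP => [E|]; rewrite ?mul0r//; case: ji; apply/eqP/val_inj.
rewrite -[RHS](min_add_excess f g); congr (_ + _).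
(* With zero excess mass the quotient is 0 by default, and the excess it should equal is a
   nonnegative term of a zero sum. *)
have [m0|mN0] := eqVneq (excess_mass f g) 0; last by rewrite mulfK.
have -> : excess f g i = 0; last by rewrite !mul0r.
have [iN|Ni] := leqP i N; last exact: excess_out.
have ex0 (n : 'I_N.+1) : true -> 0 <= excess f g n by rewrite excess_ge0.
exact: (psumr_eq0P ex0 m0 (i := Ordinal (iN : (i < N.+1)%N))).
Qed.

Section OverlapCost.
Variables f g : nat -> R.
Hypotheses (f0 : forall n, 0 <= f n) (g0 : forall n, 0 <= g n).
Hypotheses (fN : forall n, (N < n)%N -> f n = 0).
Hypotheses (gN : forall n, (N < n)%N -> g n = 0).
Hypothesis fg : \sum_(n < N.+1) f n = \sum_(n < N.+1) g n.

Lemma overlap_coupling_couplings : couplings f g (overlap_coupling f g).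
Proof.
split=> [i j|i|j]; [exact: overlap_coupling_ge0|exact: overlap_coupling_row|].
under eq_eseriesr do rewrite overlap_coupling_sym//.
exact: overlap_coupling_row.
Qed.

(** The mass kept on the diagonal travels distance 0; everything else moves by at most N. *)
Lemma overlap_cost_le (i j : 'I_N.+1) :
  overlap_coupling f g i j * `|i%:R - j%:R| `^ 2 <=
  N%:R ^+ 2 * (excess f g i * excess g f j / excess_mass f g).
Proof.
rewrite powR_mulrn//; set e := _ / _.
have e0 : 0 <= e.
  by rewrite /e !mulr_ge0 ?invr_ge0 ?excess_ge0// excess_mass_ge0.
rewrite /overlap_coupling -/e; have [->|_] := eqVneq (i : nat) j.
  by rewrite subrr normr0 expr0n mulr0 mulr_ge0 ?exprn_ge0.
rewrite mul0r add0r mulrC ler_wpM2r// lerXn2r ?nnegrE//.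
have iN : (i%:R <= N%:R :> R) by rewrite ler_nat -ltnS.
have jN : (j%:R <= N%:R :> R) by rewrite ler_nat -ltnS.
have i0 : 0 <= i%:R :> R by []; have j0 : 0 <= j%:R :> R by [].
by rewrite ler_norml; apply/andP; split; lra.
Qed.

Lemma inf_cost_le_excess_mass :
  (inf_cost 2 f g <= (N%:R ^+ 2 * excess_mass f g)%:E)%E.
Proof.
apply: ge_ereal_inf; exists (transport_cost 2 (overlap_coupling f g)).
  by exists (overlap_coupling f g) => //; exact: overlap_coupling_couplings.
have nn i j : (0 <= (overlap_coupling f g i j * `|i%:R - j%:R| `^ 2)%:E)%E.
  by rewrite lee_fin mulr_ge0 ?powR_ge0// overlap_coupling_ge0.
rewrite /transport_cost (@nneseries_finite _ _ N); last 2 first.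
- by move=> i; apply: nneseries_ge0.
- move=> i Ni; apply: eseries0 => j _ _.
  by rewrite overlap_coupling_sym// overlap_coupling_out// mul0r.
apply: (@le_trans _ _ (\sum_(i < N.+1) \sum_(j < N.+1)
    (N%:R ^+ 2 * (excess f g i * excess g f j / excess_mass f g))%:E)%E).
  apply: lee_sum => i _; rewrite (@nneseries_finite _ _ N)//; last first.
    by move=> j Nj; rewrite overlap_coupling_out// mul0r.
  by apply: lee_sum => j _; rewrite lee_fin overlap_cost_le.
under eq_bigr do rewrite sumEFin.
rewrite sumEFin lee_fin.
under eq_bigr do rewrite -mulr_sumr -mulr_suml -mulr_sumr.
rewrite -mulr_sumr -mulr_suml -mulr_suml ler_wpM2l ?exprn_ge0//.
rewrite -/(excess_mass f g) -/(excess_mass g f) -(excess_mass_sym fg).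
have [->|m0] := eqVneq (excess_mass f g) 0; first by rewrite !mul0r.
by rewrite mulfK.
Qed.

End OverlapCost.

Lemma toscani_ge0 (s : R) f g : (0 <= toscani s f g)%E.
Proof.
apply: le_trans (ereal_sup_ubound _); last first.
  by exists (2^-1); [apply/andP; split; lra|reflexivity].
by rewrite lee_fin divr_ge0 ?powR_ge0.
Qed.

(** As (1-z)^2 <= 1 on (0, 1), D_2 bounds the difference of the generating functions uniformly
    there, and interpolation then bounds its coefficients. *)
Lemma excess_mass_le_toscani f g (d : R) : distrN f -> distrN g ->
  (forall n, (N < n)%N -> f n = 0) -> (forall n, (N < n)%N -> g n = 0) ->
  toscani 2 f g = d%:E -> excess_mass f g <= interp_const N * d.
Proof.
move=> df dg fN gN dE.
apply: (@le_trans _ _ (\sum_(n < N.+1) `|f n - g n|)).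
  by apply: ler_sum => n _; exact: excess_le_norm.
apply: (@sum_coef_le _ N (fun n => f n - g n)) => z z01.
have [z0 z1] := andP z01.
have d0 : 0 <= d by rewrite -lee_fin -dE toscani_ge0.
under eq_bigr do rewrite mulrBr.
rewrite sumrB -!pgf_finite//.
have q0 : 0 < 1 - z by lra.
have : ((`|pgf f z - pgf g z| / `|1 - z| `^ 2)%:E <= d%:E)%E.
  by rewrite -dE; apply: ereal_sup_ubound; exists z.
rewrite lee_fin powR_mulrn// real_normK ?num_real// ler_pdivrMr ?exprn_gt0//.
move=> /le_trans; apply; rewrite ler_piMr// exprn_ile1//; lra.
Qed.

Lemma inf_cost_le_toscani f g (theta : R) : 0 < theta -> theta <= 1 ->
  distrN f -> distrN g -> supp f `|` supp g `<=` [set n | (n <= N)%N] ->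
  (1 <= N)%N ->
  (inf_cost 2 f g <=
    (N%:R ^+ 2 * (1 + interp_const N))%:E * toscani 2 f g `^ theta)%E.
Proof.
move=> th0 th1 df dg fgN N1.
have [fN f1] := distrN_finite df (fun n h => fgN n (or_introl h)).
have [gN g1] := distrN_finite dg (fun n h => fgN n (or_intror h)).
have [[f0 _] [g0 _]] := (df, dg).
have fg : \sum_(n < N.+1) f n = \sum_(n < N.+1) g n by rewrite f1 g1.
have NN0 : 0 < N%:R ^+ 2 :> R by rewrite exprn_gt0// ltr0n.
have K0 := @interp_const_ge0 R N.
apply: (le_trans (inf_cost_le_excess_mass f0 g0 fN gN fg)).
have := toscani_ge0 2 f g; case dE : (toscani 2 f g) => [d| |] //; last first.
  move=> _; rewrite poweRyr ?gt_eqF// gt0_muley ?leey// lte_fin.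
  by rewrite mulr_gt0//; lra.
rewrite lee_fin => d0.
rewrite poweR_EFin -EFinM lee_fin -[leRHS]mulrA ler_pM2l//.
have m0 := excess_mass_ge0 f g.
(* For d <= 1 the linear bound suffices because d <= d^theta; for d >= 1 the excess mass is at most
   1 <= d^theta. *)
have [d1|/ltW d1] := leP d 1.
  have dth : d <= d `^ theta.
    move: d0; rewrite le_eqVlt => /predU1P[<-|d0]; first exact: powR_ge0.
    by rewrite -[leLHS](powRr1 (ltW d0)) ger_powR// d0.
  apply: (le_trans (excess_mass_le_toscani df dg fN gN dE)).
  by rewrite ler_pM//; lra.
have dth : 1 <= d `^ theta.
  by rewrite -(powRr0 d) ler_powR// ltW.
have : excess_mass f g <= 1.
  by rewrite -f1; apply: ler_sum => n _; exact: excess_le.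
move=> /le_trans; apply; rewrite -[leLHS]mulr1 ler_pM//; lra.
Qed.

End FiniteSupport.

Theorem theorem1 (R : realType) :
  [/\ (forall f g : nat -> R, distrN f -> distrN g ->
        (toscani 1 f g <= wasserstein 1 f g)%E),
      (forall f g : nat -> R, distrN f -> distrN g ->
        moment 1 f = moment 1 g ->
        (toscani 2 f g <=
           (2^-1)%:E * wasserstein 2 f g ^+ 2
           + mine (moment 2 f) (moment 2 g) `^ 2^-1 * wasserstein 2 f g)%E) &
      (exists C : nat -> R -> R -> R,
        (forall (N : nat) (alpha m : R),
          (1 <= N)%N -> 0 < alpha -> 0 <= m -> 0 < C N alpha m) /\
        (forall (N : nat) (alpha : R) (f g : nat -> R),
          (1 <= N)%N -> 0 < alpha -> distrN f -> distrN g ->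
          moment 1 f = moment 1 g ->
          supp f `|` supp g `<=` [set n | (n <= N)%N] ->
          let m := maxe (moment (2 + alpha) f) (moment (2 + alpha) g) in
          (m < +oo)%E ->
          (wasserstein 2 f g ^+ 2 <=
             (C N alpha (fine m))%:E
             * toscani 2 f g `^ (alpha / (1 + alpha)))%E))].

Proof.
split.
- exact: toscani1_le_wasserstein1.
- exact: toscani2_le_wasserstein2.
(* N^2 bounds the squared displacement, and 1 + K_N covers both small and large D_2. The exponent
   alpha / (1 + alpha) lies in (0, 1]. *)
exists (fun N _ _ => N%:R ^+ 2 * (1 + interp_const N)); split.
  move=> N alpha m N1 _ _; rewrite mulr_gt0 ?exprn_gt0 ?ltr0n//.
  by rewrite ltr_wpDr ?interp_const_ge0.
move=> N alpha f g N1 a0 df dg _ fgN m _; rewrite wasserstein2_sqr.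
apply: inf_cost_le_toscani => //.
  by rewrite divr_gt0//; lra.
by rewrite ler_pdivrMr; lra.
Qed.
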